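(* Let $\Lambda$ be any $3$-graph and let $\mathcal{T}_\Lambda$ be the associated three-dimensional textile system, with graphs $G(\Lambda),F_1(\Lambda),F_2(\Lambda),E(\Lambda)$ and homomorphisms $p_1,q_1,p_2,q_2,g_1,h_1,g_2,h_2$. Then (i) $g_1,g_2$ have unique $r$-path lifting; (ii) $h_1,h_2$ have unique $s$-path lifting; (iii) the two commutative squares of sets $$q_1^0:G(\Lambda)^0\to F_1(\Lambda)^0,\quad p_2^0:G(\Lambda)^0\to F_2(\Lambda)^0,\quad g_1^0:F_1(\Lambda)^0\to E(\Lambda)^0,\quad h_2^0:F_2(\Lambda)^0\to E(\Lambda)^0\qquad (g_1^0q_1^0=h_2^0p_2^0)$$ and $$p_1^0:G(\Lambda)^0\to F_1(\Lambda)^0,\quad q_2^0:G(\Lambda)^0\to F_2(\Lambda)^0,\quad h_1^0:F_1(\Lambda)^0\to E(\Lambda)^0,\quad g_2^0:F_2(\Lambda)^0\to E(\Lambda)^0\qquad (h_1^0p_1^0=g_2^0q_2^0)$$ are pullback squares in the category of sets; (iv) $q_1$ has $s$-path lifting.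
   Context: $\mathbb{N}$ includes $0$, and $\mathbf e_1,\mathbf e_2,\mathbf e_3$ are the canonical basis vectors of $\mathbb{Z}^3$. A $k$-graph is a countable small category $\Lambda$ (codomain map $r_\Lambda$, domain map $s_\Lambda$; $\alpha\beta$ is defined when $s_\Lambda(\alpha)=r_\Lambda(\beta)$) with a functor $d:\Lambda\to\mathbb{N}^k$ satisfying unique factorization: if $d(\lambda)=\mathbf n+\mathbf m$ with $\mathbf n,\mathbf m\in\mathbb{N}^k$, there are unique $\alpha,\beta\in\Lambda$ with $d(\alpha)=\mathbf n$, $d(\beta)=\mathbf m$, $\lambda=\alpha\beta$. $\Lambda^{\mathbf n}:=d^{-1}(\mathbf n)$; $\Lambda^0$ is identified with the objects. For $0\le\mathbf n\le\mathbf m\le d(\lambda)$, $\lambda(\mathbf n,\mathbf m)$ is the unique element with $\lambda=\alpha\,\lambda(\mathbf n,\mathbf m)\,\beta$, $d(\alpha)=\mathbf n$, $d(\beta)=d(\lambda)-\mathbf m$; $\mathrm{ev}_{\mathbf n,\mathbf m}(\lambda):=\lambda(\mathbf n,\mathbf m)$. A directed graph is written $E=(E^0,E^1,r_E,s_E)$: vertices, edges, range map, source map. A graph homomorphism $f=(f^0,f^1)$ consists of a vertex map and an edge map commuting with ranges and sources. $f:F\to E$ has $r$-path lifting (resp. $s$-path lifting) if whenever $v\in F^0$, $e\in E^1$ and $f^0(v)=r_E(e)$ (resp. $f^0(v)=s_E(e)$) there is $x\in F^1$ with $r_F(x)=v$ (resp. $s_F(x)=v$) and $f^1(x)=e$;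 the lifting is unique if $x$ is always unique. A three-dimensional textile system consists of directed graphs $G,F_1,F_2,E$ and graph homomorphisms $p_1,q_1:G\to F_1$, $p_2,q_2:G\to F_2$, $g_1,h_1:F_1\to E$, $g_2,h_2:F_2\to E$ such that $g_1p_1=g_2p_2$, $h_1q_1=h_2q_2$, $g_1q_1=h_2p_2$, $h_1p_1=g_2q_2$, and the maps $s_G\times r_G\times p_1^1\times q_1^1\times p_2^1\times q_2^1$ on $G^1$, $p_1^0\times q_1^0\times p_2^0\times q_2^0$ on $G^0$, $s_{F_1}\times r_{F_1}\times g_1^1\times h_1^1$ on $F_1^1$ and $s_{F_2}\times r_{F_2}\times g_2^1\times h_2^1$ on $F_2^1$ (each sending an element to the tuple of its images) are injective. The three-dimensional textile system $\mathcal{T}_\Lambda$ associated with a $3$-graph $\Lambda$ consists of the directed graphs $G(\Lambda)=(\Lambda^{\mathbf e_1+\mathbf e_2},\Lambda^{\mathbf e_1+\mathbf e_2+\mathbf e_3},\mathrm{ev}_{\mathbf e_3,\mathbf e_1+\mathbf e_2+\mathbf e_3},\mathrm{ev}_{0,\mathbf e_1+\mathbf e_2})$, $F_1(\Lambda)=(\Lambda^{\mathbf e_2},\Lambda^{\mathbf e_2+\mathbf e_3},\mathrm{ev}_{\mathbf e_3,\mathbf e_2+\mathbf e_3},\mathrm{ev}_{0,\mathbf e_2})$, $F_2(\Lambda)=(\Lambda^{\mathbf e_1},\Lambda^{\mathbf e_1+\mathbf e_3},\mathrm{ev}_{\mathbf e_3,\mathbf e_1+\mathbf e_3},\mathrm{ev}_{0,\mathbf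 e_1})$, $E(\Lambda)=(\Lambda^0,\Lambda^{\mathbf e_3},s_\Lambda,r_\Lambda)$, and the graph homomorphisms (vertex map, edge map) $p_1=(\mathrm{ev}_{0,\mathbf e_2},\mathrm{ev}_{0,\mathbf e_2+\mathbf e_3})$, $q_1=(\mathrm{ev}_{\mathbf e_1,\mathbf e_1+\mathbf e_2},\mathrm{ev}_{\mathbf e_1,\mathbf e_1+\mathbf e_2+\mathbf e_3})$ from $G(\Lambda)$ to $F_1(\Lambda)$; $p_2=(\mathrm{ev}_{0,\mathbf e_1},\mathrm{ev}_{0,\mathbf e_1+\mathbf e_3})$, $q_2=(\mathrm{ev}_{\mathbf e_2,\mathbf e_1+\mathbf e_2},\mathrm{ev}_{\mathbf e_2,\mathbf e_1+\mathbf e_2+\mathbf e_3})$ from $G(\Lambda)$ to $F_2(\Lambda)$; $g_1=(r_\Lambda,\mathrm{ev}_{0,\mathbf e_3})$, $h_1=(s_\Lambda,\mathrm{ev}_{\mathbf e_2,\mathbf e_2+\mathbf e_3})$ from $F_1(\Lambda)$ to $E(\Lambda)$; $g_2=(r_\Lambda,\mathrm{ev}_{0,\mathbf e_3})$, $h_2=(s_\Lambda,\mathrm{ev}_{\mathbf e_1,\mathbf e_1+\mathbf e_3})$ from $F_2(\Lambda)$ to $E(\Lambda)$. *)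

(* Defs.v *)
From mathcomp Require Import all_boot all_algebra.
Set Implicit Arguments.
Unset Strict Implicit.
Unset Printing Implicit Defensive.
Import GRing.Theory.
Local Open Scope ring_scope.

(** * Countable small categories and k-graphs *)

(* [cod] and [dom] are the maps written r and s for a k-graph.  [comp a b] is
   the composite ab, meaningful only when [dom a = cod b]: no axiom constrains
   its value on a non-composable pair. *)
Record category := Category {
  obj : countType;
  mor : countType;
  cod : mor -> obj;
  dom : mor -> obj;
  ident : obj -> mor;
  comp : mor -> mor -> mor;
  cod_ident : forall v, cod (ident v) = v;
  dom_ident : forall v, dom (ident v) = v;
  cod_comp : forall a b, dom a = cod b -> cod (comp a b) = cod a;
  dom_comp : forall a b, dom a = cod b -> dom (comp a b) = dom b;
  comp_identl : forall a, comp (ident (cod a)) a = a;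
  comp_identr : forall a, comp a (ident (dom a)) = a;
  compA : forall a b c, dom a = cod b -> dom b = cod c ->
    comp a (comp b c) = comp (comp a b) c
}.

Definition degree k := {ffun 'I_k -> nat}.

Definition basis k (i : 'I_k) : degree k := [ffun j => (j == i) : nat].

Definition degree_le k (m n : degree k) : bool := [forall i, (m i <= n i)%N].

Record kgraph k := KGraph {
  kcat :> category;
  deg : mor kcat -> degree k;
  deg_ident : forall v, deg (ident v) = 0;
  deg_comp : forall a b : mor kcat, dom a = cod b ->
    deg (comp a b) = deg a + deg b;
  unique_factorization : forall (l : mor kcat) (n m : degree k),
    deg l = n + m ->
    exists! ab : mor kcat * mor kcat,
      [/\ deg ab.1 = n, deg ab.2 = m, dom ab.1 = cod ab.2 &
          l = comp ab.1 ab.2]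
}.

(* The set of morphisms of degree n. *)
Definition mor_deg k (L : kgraph k) (n : degree k) : Type :=
  {l : mor L | deg l == n}.

Section Segments.
Variables (k : nat) (L : kgraph k).
Implicit Types (n m p q : degree k) (a b c l u : mor L).

(* l = a u b with d(a) = n and d(b) = d(l) - m, the last condition being
   written without subtraction. *)
Definition splits n m l a u b : bool :=
  [&& dom a == cod u, dom u == cod b, comp a (comp u b) == l,
      deg a == n & deg b + m == deg l].

Definition segment n m l u := exists a b, splits n m l a u b.

Lemma degree_addI n m p : n + m = n + p -> m = p.
Proof.
by move/ffunP=> E; apply/ffunP=> i; move: (E i); rewrite !ffunE => /addnI.
Qed.

Lemma degree_leP n m : degree_le n m -> exists p, m = n + p.
Proof.
move/forallP=> H; exists [ffun i => (m i - n i)%N].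
by apply/ffunP=> i; rewrite !ffunE /= [(_ + _)%R]subnKC.
Qed.

Lemma comp_inj a b a' b' : dom a = cod b -> dom a' = cod b' ->
  deg a = deg a' -> comp a b = comp a' b' -> a = a' /\ b = b'.
Proof.
move=> h h' da e.
have db : deg b = deg b'.
  by apply: (@degree_addI (deg a)); rewrite -deg_comp // e deg_comp // da.
have [t [_ U]] := unique_factorization (deg_comp h).
have E1 : t = (a, b) by apply: U.
have E2 : t = (a', b') by apply: U; split=> /=.
by move: E2; rewrite E1 => -[].
Qed.

Lemma segment_ex n m l q : n + q = m -> degree_le m (deg l) ->
  exists t : mor L * mor L * mor L, splits n m l t.1.1 t.1.2 t.2.
Proof.
move=> E /degree_leP[p dl].
have [[a c] [/= [da dc hac El] _]] := unique_factorization
  (etrans dl (etrans (congr1 (+%R^~ p) (esym E)) (esym (addrA n q p)))).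
have [[u b] [/= [du db hub Ec] _]] := unique_factorization dc.
exists (a, u, b); rewrite /splits /= hac El Ec cod_comp // hub !eqxx da eqxx /=.
by rewrite -Ec -El dl db addrC.
Qed.

Lemma segment_uniq n m l u u' : segment n m l u -> segment n m l u' -> u = u'.
Proof.
move=> [a [b /and5P[/eqP h1 /eqP h2 /eqP e /eqP da /eqP db]]].
move=> [a' [b' /and5P[/eqP h1' /eqP h2' /eqP e' /eqP da' /eqP db']]].
have [||||Ea Ec] := @comp_inj a (comp u b) a' (comp u' b').
- by rewrite cod_comp.
- by rewrite cod_comp.
- by rewrite da da'.
- by rewrite e e'.
have dbb : deg b = deg b'.
  by apply: (@degree_addI m); rewrite addrC db addrC db'.
have [||||//] := @comp_inj u b u' b'; [by []|by []| |by []].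
apply: (@degree_addI (deg b)); rewrite [LHS]addrC -(deg_comp h2) Ec (deg_comp h2').
by rewrite dbb addrC.
Qed.

Lemma segment_deg n m l u q : segment n m l u -> n + q = m -> deg u = q.
Proof.
move=> [a [b /and5P[/eqP h1 /eqP h2 /eqP e /eqP da /eqP db]]] E.
apply: (@degree_addI (deg b + n)).
by rewrite -[RHS]addrA E db -e !deg_comp ?cod_comp // da -addrA addrC addrA.
Qed.

Lemma segment_trans n m n' m' l u w :
  segment n m l u -> segment n' m' u w -> segment (n + n') (n + m') l w.
Proof.
move=> [a [b /and5P[/eqP h1 /eqP h2 /eqP e /eqP da /eqP db]]].
move=> [c [z /and5P[/eqP h3 /eqP h4 /eqP e' /eqP dc /eqP dz]]].
have cu : cod u = cod c by rewrite -e' cod_comp // cod_comp.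
have du : dom u = dom z by rewrite -e' !dom_comp // cod_comp.
exists (comp a c), (comp z b).
have hac : dom a = cod c by rewrite h1.
have hzb : dom z = cod b by rewrite -du.
have hwzb : dom w = cod (comp z b) by rewrite cod_comp.
rewrite /splits dom_comp // h3 eqxx hwzb eqxx /=; apply/and3P; split.
- rewrite -e -e' -[comp a c]/(comp a c) -compA //; last by rewrite cod_comp.
  rewrite -[comp (comp c (comp w z)) b]compA ?dom_comp ?cod_comp //.
  by rewrite -[comp (comp w z) b]compA.
- by rewrite deg_comp // da dc.
- rewrite deg_comp // -e !deg_comp ?cod_comp // da -dz.
  by rewrite [deg z + _]addrC -addrA [_ + (n + _)]addrCA addrCA [deg b + _]addrC.
Qed.

Lemma segment_full l : segment 0 (deg l) l l.
Proof.
exists (ident (cod l)), (ident (dom l)); rewrite /splits dom_ident cod_ident !eqxx /=.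
by rewrite comp_identr comp_identl !deg_ident add0r !eqxx.
Qed.

Lemma segment_left n m l u : segment n m l u -> segment n n l (ident (cod u)).
Proof.
move=> [a [b /and5P[/eqP h1 /eqP h2 /eqP e /eqP da /eqP db]]].
exists a, (comp u b); rewrite /splits cod_ident dom_ident h1 cod_comp // !eqxx /=.
rewrite -{1}(cod_comp h2) comp_identl e eqxx da eqxx /=.
by rewrite -e !deg_comp ?cod_comp // da [X in _ == X]addrC.
Qed.

Lemma segment_right n m l u : segment n m l u -> segment m m l (ident (dom u)).
Proof.
move=> [a [b /and5P[/eqP h1 /eqP h2 /eqP e /eqP da /eqP db]]].
exists (comp a u), b; rewrite /splits cod_ident dom_ident dom_comp // h2 !eqxx /=.
rewrite comp_identl -compA // e eqxx db eqxx andbT /= deg_comp //.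
apply/eqP/(@degree_addI (deg b)); rewrite db -e !deg_comp ?cod_comp //.
by rewrite [LHS]addrC -addrA.
Qed.

Lemma segment_cat n l a b : segment 0 n l a -> segment n (deg l) l b ->
  l = comp a b.
Proof.
move=> [a1 [b1 /and5P[/eqP h1 /eqP h2 /eqP e /eqP da /eqP db]]].
move=> [a2 [b2 /and5P[/eqP h3 /eqP h4 /eqP e' /eqP da' /eqP db']]].
have deg0 c : deg c = 0 -> c = ident (cod c).
  move=> dc; have [|||| //] := @comp_inj c (ident (dom c)) (ident (cod c)) c.
  - by rewrite cod_ident.
  - by rewrite dom_ident.
  - by rewrite dc deg_ident.
  - by rewrite comp_identl comp_identr.
have E1 : comp a b1 = l.
  rewrite -e (deg0 a1) // -{1}(dom_ident (cod a1)) -deg0 // h1 -(cod_comp h2).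
  by rewrite comp_identl.
have b20 : deg b2 = 0.
  by apply: (@degree_addI (deg l)); rewrite addrC db' addr0.
have E2 : comp a2 b = l.
  by rewrite -e' (deg0 b2) // -h4 comp_identr.
have [|||| <- _] := @comp_inj a2 b a b1; rewrite ?E1 ?E2 //.
rewrite da'; apply: (@degree_addI (deg b1)).
by rewrite db -E1 deg_comp // addrC.
Qed.

(* The map ev_{n,m}, from the morphisms of degree p to those of degree
   q = m - n, for 0 <= n <= m <= p. *)
Section Ev.
Variables (n m p q : degree k) (H : (n + q == m) && degree_le m p).

Lemma ev_ex (l : mor_deg L p) : exists t : mor L * mor L * mor L,
  splits n m (val l) t.1.1 t.1.2 t.2.
Proof.
case/andP: H => /eqP E le; apply: (segment_ex E).
by rewrite (eqP (valP l)).
Qed.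

Definition ev_mor (l : mor_deg L p) : mor L := (xchoose (ev_ex l)).1.2.

Lemma ev_segment (l : mor_deg L p) : segment n m (val l) (ev_mor l).
Proof.
rewrite /ev_mor; have := xchooseP (ev_ex l).
by case: (xchoose _) => [[a u] b] S; exists a, b.
Qed.

Lemma ev_deg (l : mor_deg L p) : deg (ev_mor l) == q.
Proof. by case/andP: H => /eqP E _; rewrite (segment_deg (ev_segment l) E). Qed.

Definition ev (l : mor_deg L p) : mor_deg L q := exist _ (ev_mor l) (ev_deg l).

(* [ev] is the map lambda |-> lambda(n,m) of the unique factorization. *)
Lemma evP (l : mor_deg L p) (u : mor L) : segment n m (val l) u <-> u = val (ev l).
Proof.
split=> [S | ->]; last exact: ev_segment.
exact: segment_uniq S (ev_segment l).
Qed.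

End Ev.

(* The identification of the objects with the morphisms of degree 0. *)
Definition vertex (v : obj L) : mor_deg L 0 :=
  exist _ (ident v) (introT eqP (@deg_ident k L v)).

Lemma vertex_bij : bijective vertex.
Proof.
exists (fun l : mor_deg L 0 => cod (val l)) => [v | l]; first by rewrite /= cod_ident.
apply: val_inj => /=; apply: (@segment_uniq 0 0 (val l)).
  exact: segment_left (segment_full _).
by have := segment_full (val l); rewrite (eqP (valP l)).
Qed.

End Segments.

Arguments ev {k L} n m {p q} H.

(** * Directed graphs *)

Record digraph := Digraph {
  vert : Type;
  edge : Type;
  range : edge -> vert;
  source : edge -> vert
}.

Record ghom (F E : digraph) := GHom {
  vmap : vert F -> vert E;
  emap : edge F -> edge E;
  vmap_range : forall x, vmap (range x) = range (emap x);
  vmap_source : forall x, vmap (source x) = source (emap x)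
}.

Definition r_path_lifting F E (f : ghom F E) :=
  forall (v : vert F) (e : edge E), vmap f v = range e ->
  exists x : edge F, range x = v /\ emap f x = e.

Definition s_path_lifting F E (f : ghom F E) :=
  forall (v : vert F) (e : edge E), vmap f v = source e ->
  exists x : edge F, source x = v /\ emap f x = e.

Definition unique_r_path_lifting F E (f : ghom F E) :=
  forall (v : vert F) (e : edge E), vmap f v = range e ->
  exists! x : edge F, range x = v /\ emap f x = e.

Definition unique_s_path_lifting F E (f : ghom F E) :=
  forall (v : vert F) (e : edge E), vmap f v = source e ->
  exists! x : edge F, source x = v /\ emap f x = e.

(* The square  f : A -> B, g : A -> C, f' : B -> D, g' : C -> D  commutes and
   has the universal property of a pullback in the category of sets. *)
Definition is_pullback (A B C D : Type)
    (f : A -> B) (g : A -> C) (f' : B -> D) (g' : C -> D) : Prop :=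
  f' \o f =1 g' \o g /\
  forall (X : Type) (u : X -> B) (v : X -> C), f' \o u =1 g' \o v ->
  exists w : X -> A, (f \o w =1 u /\ g \o w =1 v) /\
    forall w' : X -> A, f \o w' =1 u -> g \o w' =1 v -> w' =1 w.

(** * Three-dimensional textile systems *)

Definition same_composite (G F F' E : digraph)
    (g : ghom F E) (p : ghom G F) (g' : ghom F' E) (p' : ghom G F') : Prop :=
  vmap g \o vmap p =1 vmap g' \o vmap p' /\
  emap g \o emap p =1 emap g' \o emap p'.

Record textile3 := Textile3 {
  tG : digraph; tF1 : digraph; tF2 : digraph; tE : digraph;
  p1 : ghom tG tF1; q1 : ghom tG tF1;
  p2 : ghom tG tF2; q2 : ghom tG tF2;
  g1 : ghom tF1 tE; h1 : ghom tF1 tE;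
  g2 : ghom tF2 tE; h2 : ghom tF2 tE;
  g1p1 : same_composite g1 p1 g2 p2;
  h1q1 : same_composite h1 q1 h2 q2;
  g1q1 : same_composite g1 q1 h2 p2;
  h1p1 : same_composite h1 p1 g2 q2;
  G_edge_inj : injective (fun x : edge tG =>
    (source x, range x, emap p1 x, emap q1 x, emap p2 x, emap q2 x));
  G_vert_inj : injective (fun x : vert tG =>
    (vmap p1 x, vmap q1 x, vmap p2 x, vmap q2 x));
  F1_edge_inj : injective (fun x : edge tF1 =>
    (source x, range x, emap g1 x, emap h1 x));
  F2_edge_inj : injective (fun x : edge tF2 =>
    (source x, range x, emap g2 x, emap h2 x))
}.

(** * The textile system of a 3-graph *)

Definition e1 : degree 3 := basis (Ordinal (isT : 0 < 3)%N).
Definition e2 : degree 3 := basis (Ordinal (isT : 1 < 3)%N).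
Definition e3 : degree 3 := basis (Ordinal (isT : 2 < 3)%N).

Ltac degree_tac :=
  apply/andP; split;
  [ apply/eqP/ffunP | apply/forallP ];
  case=> [[|[|[|?]]] ?] //; rewrite !ffunE //.

#[local] Obligation Tactic := degree_tac.

Section TextileOf.
Variable L : kgraph 3.

Program Definition GL : digraph := @Digraph
  (mor_deg L (e1 + e2)) (mor_deg L (e1 + e2 + e3))
  (ev e3 (e1 + e2 + e3) _) (ev 0 (e1 + e2) _).

Program Definition F1L : digraph := @Digraph
  (mor_deg L e2) (mor_deg L (e2 + e3)) (ev e3 (e2 + e3) _) (ev 0 e2 _).

Program Definition F2L : digraph := @Digraph
  (mor_deg L e1) (mor_deg L (e1 + e3)) (ev e3 (e1 + e3) _) (ev 0 e1 _).

(* The vertices are the objects, identified with the morphisms of degree 0 by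
   [vertex_bij].  The range map of this graph is the source map of the 3-graph,
   and conversely. *)
Definition EL : digraph := @Digraph
  (obj L) (mor_deg L e3) (fun l => dom (val l)) (fun l => cod (val l)).

Lemma ev_comm (n1 m1 p q1 n1' m1' q n2 m2 q2 n2' m2' : degree 3) H1 H1' H2 H2'
    (l : mor_deg L p) :
  n1 + n1' = n2 + n2' -> n1 + m1' = n2 + m2' ->
  @ev 3 L n1' m1' q1 q H1' (@ev 3 L n1 m1 p q1 H1 l) =
  @ev 3 L n2' m2' q2 q H2' (@ev 3 L n2 m2 p q2 H2 l).
Proof.
move=> E E'; apply: val_inj.
have S1 := segment_trans (ev_segment H1 l) (ev_segment H1' (ev n1 m1 H1 l)).
have S2 := segment_trans (ev_segment H2 l) (ev_segment H2' (ev n2 m2 H2 l)).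
by rewrite E E' in S1; apply: segment_uniq S1 S2.
Qed.

Lemma ident_inj : injective (@ident L).
Proof. exact: can_inj (@cod_ident L). Qed.

Lemma dom_cod_ev n m p q H m' q' H' (l : mor_deg L p) :
  dom (val (@ev 3 L n m p q H l)) = cod (val (@ev 3 L m m' p q' H' l)).
Proof.
apply: ident_inj; apply: (@segment_uniq 3 L m m (val l)).
  exact: segment_right (ev_segment H l).
exact: segment_left (ev_segment H' l).
Qed.

Lemma cod_ev n m p q H m' q' H' (l : mor_deg L p) :
  cod (val (@ev 3 L n m p q H l)) = cod (val (@ev 3 L n m' p q' H' l)).
Proof.
apply: ident_inj; apply: (@segment_uniq 3 L n n (val l)).
  exact: segment_left (ev_segment H l).
exact: segment_left (ev_segment H' l).
Qed.

Lemma dom_ev n m p q H n' q' H' (l : mor_deg L p) :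
  dom (val (@ev 3 L n m p q H l)) = dom (val (@ev 3 L n' m p q' H' l)).
Proof.
apply: ident_inj; apply: (@segment_uniq 3 L m m (val l)).
  exact: segment_right (ev_segment H l).
exact: segment_right (ev_segment H' l).
Qed.

Lemma ev_cat_inj n p q q' H H' (l l' : mor_deg L p) :
  @ev 3 L 0 n p q H l = @ev 3 L 0 n p q H l' ->
  @ev 3 L n p p q' H' l = @ev 3 L n p p q' H' l' -> l = l'.
Proof.
move=> E E'; apply: val_inj.
have cat (x : mor_deg L p) :
    val x = comp (val (@ev 3 L 0 n p q H x)) (val (@ev 3 L n p p q' H' x)).
  apply: (@segment_cat _ _ n); first exact: ev_segment.
  by rewrite (eqP (valP x)); exact: ev_segment.
by rewrite cat [RHS]cat E E'.
Qed.

Ltac comm_tac := move=> ? /=;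
  first [ exact: cod_ev | exact: dom_ev | exact: dom_cod_ev
        | exact/esym/dom_cod_ev
        | apply: ev_comm; apply/ffunP;
          case=> [[|[|[|?]]] ?] //; rewrite !ffunE // ].

#[local] Obligation Tactic := first [degree_tac | comm_tac].

Program Definition p1L : ghom GL F1L := @GHom GL F1L
  (ev 0 e2 _) (ev 0 (e2 + e3) _) _ _.
Program Definition q1L : ghom GL F1L := @GHom GL F1L
  (ev e1 (e1 + e2) _) (ev e1 (e1 + e2 + e3) _) _ _.
Program Definition p2L : ghom GL F2L := @GHom GL F2L
  (ev 0 e1 _) (ev 0 (e1 + e3) _) _ _.
Program Definition q2L : ghom GL F2L := @GHom GL F2L
  (ev e2 (e1 + e2) _) (ev e2 (e1 + e2 + e3) _) _ _.

Program Definition g1L : ghom F1L EL := @GHom F1L EL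
  (fun l => cod (val l)) (ev 0 e3 _) _ _.
Program Definition h1L : ghom F1L EL := @GHom F1L EL
  (fun l => dom (val l)) (ev e2 (e2 + e3) _) _ _.
Program Definition g2L : ghom F2L EL := @GHom F2L EL
  (fun l => cod (val l)) (ev 0 e3 _) _ _.
Program Definition h2L : ghom F2L EL := @GHom F2L EL
  (fun l => dom (val l)) (ev e1 (e1 + e3) _) _ _.

Lemma g1p1L : same_composite g1L p1L g2L p2L.
Proof. by split; comm_tac. Qed.

Lemma h1q1L : same_composite h1L q1L h2L q2L.
Proof. by split; comm_tac. Qed.

Lemma g1q1L : same_composite g1L q1L h2L p2L.
Proof. by split; comm_tac. Qed.

Lemma h1p1L : same_composite h1L p1L g2L q2L.
Proof. by split; comm_tac. Qed.

Lemma G_vert_injL : injective (fun x : vert GL =>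
  (vmap p1L x, vmap q1L x, vmap p2L x, vmap q2L x)).
Proof.
move=> x y E.
exact: ev_cat_inj (congr1 (fun t => t.1.2) E) (congr1 (fun t => t.1.1.2) E).
Qed.

Lemma F1_edge_injL : injective (fun x : edge F1L =>
  (source x, range x, emap g1L x, emap h1L x)).
Proof.
move=> x y E.
exact: ev_cat_inj (congr1 (fun t => t.1.1.1) E) (congr1 (fun t => t.2) E).
Qed.

Lemma F2_edge_injL : injective (fun x : edge F2L =>
  (source x, range x, emap g2L x, emap h2L x)).
Proof.
move=> x y E.
exact: ev_cat_inj (congr1 (fun t => t.1.1.1) E) (congr1 (fun t => t.2) E).
Qed.

Lemma G_edge_injL : injective (fun x : edge GL =>
  (source x, range x, emap p1L x, emap q1L x, emap p2L x, emap q2L x)).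
Proof.
have H : (0 + e1 == e1) && degree_le e1 (e1 + e2 + e3) by degree_tac.
have H' : (0 + e1 == e1) && degree_le e1 (e1 + e2) by degree_tac.
have E (x : edge GL) :
    @ev 3 L 0 e1 _ _ H x = @ev 3 L 0 e1 _ _ H' (source x).
  apply: val_inj; apply/esym/evP.
  have := segment_trans (ev_segment _ x) (ev_segment H' (source x)).
  by rewrite !add0r; apply.
move=> x y Exy.
apply: (ev_cat_inj (H := H)) (congr1 (fun t => t.1.1.2) Exy).
by rewrite !E (congr1 (fun t => t.1.1.1.1.1) Exy : source x = source y).
Qed.

Definition textile_of : textile3 := Textile3
  g1p1L h1q1L g1q1L h1p1L G_edge_injL G_vert_injL F1_edge_injL F2_edge_injL.

End TextileOf.

(* Main.v *)
Require Import Defs.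
From mathcomp Require Import all_boot all_algebra.
Set Implicit Arguments.
Unset Strict Implicit.
Unset Printing Implicit Defensive.

(** The range of an edge of [E] is its domain in the 3-graph, so every lifting
    or pullback problem in (i)-(iii) amounts to a composable pair, whose
    composite is the solution, unique by unique factorization.  For (iv), given
    a square [v] and an edge [e] whose source is the final segment of [v], the
    lift is [a e], where [a] is the initial segment of [v] of degree [e1]. *)

Import GRing.Theory.
Local Open Scope ring_scope.

Section Composites.
Variables (k : nat) (L : kgraph k).
Implicit Types a b : mor L.

Lemma segment_compl a b :
  dom a = cod b -> segment 0 (deg a) (Defs.comp a b) a.
Proof.
move=> h; exists (ident (cod a)), b.
rewrite /splits dom_ident h !eqxx deg_ident deg_comp // addrC !eqxx !andbT /=.
by rewrite -(cod_comp h) comp_identl.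
Qed.

Lemma segment_compr a b :
  dom a = cod b -> segment (deg a) (deg a + deg b) (Defs.comp a b) b.
Proof.
move=> h; exists a, (ident (dom b)).
by rewrite /splits cod_ident h comp_identr !eqxx deg_ident deg_comp // add0r eqxx.
Qed.

Variables (n q p : degree k) (H : (0 + n == n) && degree_le n p)
  (H' : (n + q == p) && degree_le p p).
Variables (a : mor_deg L n) (b : mor_deg L q) (h : dom (val a) = cod (val b)).

Lemma comp_degP : deg (Defs.comp (val a) (val b)) == p.
Proof.
by case/andP: H' => /eqP <- _; rewrite deg_comp // (eqP (valP a)) (eqP (valP b)).
Qed.

(** The degree [p] is only provably equal to [n + q], so [e1 + e2] can be split with either factor
    first without a transport. *)
Definition comp_deg : mor_deg L p := exist _ (Defs.comp (val a) (val b)) comp_degP.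

Lemma ev_compl : ev 0 n H comp_deg = a.
Proof.
apply/val_inj/esym/evP => /=.
by have := segment_compl h; rewrite (eqP (valP a)).
Qed.

Lemma ev_compr : ev n p H' comp_deg = b.
Proof.
apply/val_inj/esym/evP => /=; case/andP: (H') => /eqP Ep _.
by have := segment_compr h; rewrite (eqP (valP a)) (eqP (valP b)) Ep.
Qed.

End Composites.

Section ThreeGraph.
Variables (L : kgraph 3) (n q p : degree 3).
Variables (H : (0 + n == n) && degree_le n p)
  (H' : (n + q == p) && degree_le p p).

(** The composite of [a] and [b] is a solution, and a path is determined by its two complementary
    segments. The lifts by [h1], [h2] take [a] as the vertex, those by [g1], [g2] take [b]. *)
Lemma ev_comp_uniq (a : mor_deg L n) (b : mor_deg L q) :
  dom (val a) = cod (val b) ->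
  exists! x : mor_deg L p, ev 0 n H x = a /\ ev n p H' x = b.
Proof.
move=> h; exists (comp_deg H' h); split; first by rewrite ev_compl ev_compr.
move=> y [ya yb].
by apply: (@ev_cat_inj L n p _ _ H H'); rewrite ?ev_compl ?ev_compr.
Qed.

(** The mediating map sends [x] to the composite of [v x] and [u x], composable because the two legs
    agree at [x]. *)
Lemma ev_pullback :
  is_pullback (@ev 3 L n p p q H') (@ev 3 L 0 n p n H)
    (fun b => cod (val b)) (fun a => dom (val a)).
Proof.
split=> [x | X u v E] /=; first exact/esym/dom_cod_ev.
pose w x : mor_deg L p := comp_deg H' (esym (E x)).
exists w; split=> [|w' wu wv x].
  by split=> x /=; rewrite ?ev_compl ?ev_compr.
by apply: (@ev_cat_inj L n p _ _ H H');
  rewrite ?ev_compl ?ev_compr; [apply: wv | apply: wu].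
Qed.

Lemma ev_initial m H0 H1 (x : mor_deg L p) :
  @ev 3 L 0 n m n H0 (@ev 3 L 0 m p m H1 x) = ev 0 n H x.
Proof.
apply/val_inj/evP.
by have := segment_trans (ev_segment H1 x) (ev_segment H0 (ev 0 m H1 x));
  rewrite !add0r.
Qed.

End ThreeGraph.

(** Both identities are the empty segment of [l] at 0. *)
Lemma cod_ev0 (L : kgraph 3) m p q H (l : mor_deg L p) :
  cod (val (@ev 3 L 0 m p q H l)) = cod (val l).
Proof.
apply: (@ident_inj L); apply: (@segment_uniq 3 L 0 0 (val l)).
  exact: segment_left (ev_segment H l).
exact: segment_left (segment_full _).
Qed.

Lemma is_pullback_sym A B C D (f : A -> B) (g : A -> C) (f' : B -> D)
  (g' : C -> D) : is_pullback f g f' g' -> is_pullback g f g' f'.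
Proof.
case=> E U; split=> [x | X v u vu]; first exact/esym/E.
have [x | w [[wu wv] wuniq]] := U X u v; first exact/esym/vu.
by exists w; split=> // w' w'v w'u; apply: wuniq.
Qed.

(** In r-path lifting the vertex is the final segment, so the two conditions come in the opposite
    order to [ev_comp_uniq]. *)
Lemma exists_uniq_andC T (P Q : T -> Prop) :
  (exists! x, P x /\ Q x) -> exists! x, Q x /\ P x.
Proof. by case=> x [[Px Qx] U]; exists x; split=> // y [Qy Py]; apply: U. Qed.

Theorem proposition7p2 (L : kgraph 3) :
  let T := textile_of L in
  (unique_r_path_lifting (g1 T) /\ unique_r_path_lifting (g2 T)) /\
  (unique_s_path_lifting (h1 T) /\ unique_s_path_lifting (h2 T)) /\
  (is_pullback (vmap (q1 T)) (vmap (p2 T)) (vmap (g1 T)) (vmap (h2 T)) /\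
   is_pullback (vmap (p1 T)) (vmap (q2 T)) (vmap (h1 T)) (vmap (g2 T))) /\
  s_path_lifting (q1 T).
Proof.
move=> T; split; [|split; [|split]].
- by split=> v e E; apply: exists_uniq_andC; apply: ev_comp_uniq.
- by split=> v e E; apply: ev_comp_uniq.
- by split; [|apply: is_pullback_sym]; apply: ev_pullback.
move=> v e Ev.
have H : (0 + e1 == e1) && degree_le e1 (e1 + e2 + e3) by degree_tac.
have H' : (e1 + (e2 + e3) == e1 + e2 + e3) &&
  degree_le (e1 + e2 + e3) (e1 + e2 + e3) by degree_tac.
(* The square [g1 q1 = h2 p2] at [v] turns the left side into the range of [q1 v], which is the
   initial [e2]-segment of [e]. *)
have h : dom (val (vmap (p2 T) v)) = cod (val e).
  rewrite -[LHS](proj1 (g1q1L L) v).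
  apply: etrans (congr1 (fun l : mor_deg L e2 => cod (val l)) Ev) _.
  exact: cod_ev0.
have [x [[xa xe] _]] := ev_comp_uniq H H' h.
pose y : edge (tG T) := x.
have qy : emap (q1 T) y = e.
  (* The two sides differ only in the proof of the degree bounds. *)
  by rewrite -xe; congr (ev _ _ _ x); apply: bool_irrelevance.
exists y; split=> //.
(* [source y] equals [v] once their initial [e1]-segments and final [e2]-segments agree. *)
have p2y : vmap (p2 T) (source y) = vmap (p2 T) v.
  by rewrite -xa; apply: ev_initial.
have q1y : vmap (q1 T) (source y) = vmap (q1 T) v.
  by rewrite vmap_source qy.
exact: ev_cat_inj p2y q1y.
Qed.
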